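(* Let $\vartheta\in\{p,bp,r\}$ and let $A=(a_{mnkl})_{m,n,k,l\in\mathbb{N}}$ be a four-dimensional complex matrix. Then $A\in([\mathcal{C}_f]:\mathcal{M}_u)$ if and only if $A_{mn}=(a_{mnkl})_{k,l\in\mathbb{N}}\in\{[\mathcal{C}_f]\}^{\beta(\vartheta)}$ for all $m,n\in\mathbb{N}$ and $$\sup_{m,n\in\mathbb{N}}\sum_{k,l}|a_{mnkl}|<\infty .$$
   Context: $\mathbb{N}=\{0,1,2,\dots\}$; $\Omega$ is the vector space of all complex double sequences $x=(x_{kl})_{k,l\in\mathbb{N}}$. $\mathcal{M}_u=\{x\in\Omega:\sup_{k,l}|x_{kl}|<\infty\}$. $\mathcal{C}_p$ is the set of double sequences convergent in Pringsheim's sense (both indices tend to infinity independently; limit $p$-$\lim$); $\mathcal{C}_{bp}=\mathcal{C}_p\cap\mathcal{M}_u$; $\mathcal{C}_r$ is the set of members of $\mathcal{C}_p$ all of whose rows and columns are convergent single sequences. For $\vartheta\in\{p,bp,r\}$, a double series is $\vartheta$-convergent if its sequence of rectangular partial sums lies in $\mathcal{C}_\vartheta$; $\mathcal{CS}_\vartheta$ is the set of $x\in\Omega$ for which $\sum_{k,l}x_{kl}$ is $\vartheta$-convergent. The $\beta(\vartheta)$-dual of $\lambda\subset\Omega$ is $\lambda^{\beta(\vartheta)}=\{a\in\Omega:(a_{kl}x_{kl})\in\mathcal{CS}_\vartheta\text{ for all }x\in\lambda\}$. For $\lambda,\mu\subset\Omega$, $A\in(\lambda:\mu)$ means that for every $x\in\lambda$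 the series $(Ax)_{mn}=\vartheta\text{-}\sum_{k,l}a_{mnkl}x_{kl}$ is $\vartheta$-convergent for all $m,n$ and $Ax=((Ax)_{mn})\in\mu$. $[\mathcal{C}_f]$ (strongly almost convergent double sequences) is the set of $x\in\Omega$ for which there is $L\in\mathbb{C}$ with $$p\text{-}\lim_{q,q'\to\infty}\ \sup_{m,n\in\mathbb{N}}\frac{1}{(q+1)(q'+1)}\sum_{k=m}^{m+q}\sum_{l=n}^{n+q'}|x_{kl}-L|=0.$$ *)

(* Defs.v *)
From HB Require Import structures.
From mathcomp Require Import all_boot all_order all_algebra.
From mathcomp Require Import all_classical all_reals all_analysis.
From mathcomp.real_closed Require Import complex.

Set Implicit Arguments.
Unset Strict Implicit.
Unset Printing Implicit Defensive.

Import Order.TTheory GRing.Theory Num.Theory.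
Import numFieldNormedType.Exports.

Local Open Scope classical_set_scope.
Local Open Scope ring_scope.

(* The norm [`|z|] of [z : R[i]] lives in [R[i]]; [cabs z] is the modulus of z
   as an element of [R]. *)
Notation cabs := ComplexField.Normc.normc.

Definition dseq (R : realType) := nat -> nat -> R[i].
Definition dmatrix (R : realType) := nat -> nat -> dseq R.

Section DoubleSequences.
Context {R : realType}.
(* [R[i]] receives its (modulus) topology only through its field structure. *)
Local Notation C := (R[i] : numFieldType).
Implicit Types (x a : dseq R) (A : dmatrix R) (E F : set (dseq R)).

Definition bounded_dseq : set (dseq R) :=
  [set x | (ereal_sup (range (fun kl : nat * nat =>
                                (cabs (x kl.1 kl.2))%:E)) < +oo)%E].

Definition p_filter x : set_system C := x kl.1 kl.2 @[kl --> (\oo, \oo)].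

Definition p_lim x : R[i] := lim (p_filter x).

Definition Cp : set (dseq R) := [set x | cvg (p_filter x)].

Definition Cbp : set (dseq R) := Cp `&` bounded_dseq.

Definition Cr : set (dseq R) :=
  Cp `&` [set x | (forall k, cvg ((x k l : C) @[l --> \oo])) /\
                  (forall l, cvg ((x k l : C) @[k --> \oo]))].

Variant cvg_mode := p_mode | bp_mode | r_mode.

Definition Cmode (v : cvg_mode) : set (dseq R) :=
  match v with p_mode => Cp | bp_mode => Cbp | r_mode => Cr end.

Definition rect_sums x : dseq R :=
  fun m n => \sum_(k < m.+1) \sum_(l < n.+1) x k l.

Definition CS (v : cvg_mode) : set (dseq R) := [set x | Cmode v (rect_sums x)].

(* All three modes refine Pringsheim convergence, and the sum of a v-convergent
   double series is its Pringsheim limit. *)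
Definition dsum x : R[i] := p_lim (rect_sums x).

Definition mul_dseq a x : dseq R := fun k l => a k l * x k l.

Definition beta_dual (v : cvg_mode) E : set (dseq R) :=
  [set a | forall x, E x -> CS v (mul_dseq a x)].

Definition transform A x : dseq R := fun m n => dsum (mul_dseq (A m n) x).

Definition matrix_class (v : cvg_mode) E F : set (dmatrix R) :=
  [set A | forall x, E x ->
     (forall m n, CS v (mul_dseq (A m n) x)) /\ F (transform A x)].

(* Supremum over all windows of size (q+1) x (q'+1), taken in [\bar R] since it
   may be infinite. *)
Definition window_dev x (L : R[i]) (q q' : nat) : \bar R :=
  ereal_sup (range (fun mn : nat * nat =>
    (((q.+1)%:R * (q'.+1)%:R)^-1 *
     \sum_(mn.1 <= k < mn.1 + q.+1) \sum_(mn.2 <= l < mn.2 + q'.+1)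
        cabs (x k l - L))%:E)).

Definition strongly_almost_cvg : set (dseq R) :=
  [set x | exists L : R[i],
     window_dev x L qq.1 qq.2 @[qq --> (\oo, \oo)] --> 0%E].

End DoubleSequences.

(* Main.v *)
(** Members of [C_f] are bounded, which gives sufficiency.  For necessity only
    the double sequences vanishing as [max k l] tends to infinity matter.  A
    gliding hump in the style of Sokal's elementary proof of the uniform
    boundedness principle works with finitely supported humps of size [9^-n]
    whose signs are chosen so that the [n]-th functional is large after the
    [n]-th step; the later humps are too small to undo this.  It is used twice:
    on the seminorms [x |-> sum_{k,l < K} |a_kl x_kl|], where rotating phases
    makes the series nonnegative, so that Pringsheim convergence bounds all its
    rectangular sums and each row of [A] is absolutely summable; and then on
    the functionals [x |-> (A x)_mn]. *)

Require Import Defs.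
From HB Require Import structures.
From mathcomp Require Import all_boot all_order all_algebra.
From mathcomp Require Import all_classical all_reals all_analysis.
From mathcomp.real_closed Require Import complex.
From mathcomp Require Import lra ring.

Set Implicit Arguments.
Unset Strict Implicit.
Unset Printing Implicit Defensive.

Import Order.TTheory GRing.Theory Num.Theory.
Import numFieldNormedType.Exports.

Local Open Scope classical_set_scope.
Local Open Scope ring_scope.

(** * The real-valued modulus and the phase of a complex number *)

Section Modulus.
Context {R : realType}.
Implicit Types (z w : R[i]) (r : R).

Lemma cabs_ge0 z : 0 <= cabs z.
Proof. by case: z => a b; exact: sqrtr_ge0. Qed.

Lemma cabsD z w : cabs (z + w) <= cabs z + cabs w.
Proof. by rewrite -lecR rmorphD; exact: (ler_normD z w). Qed.

Lemma cabsN z : cabs (- z) = cabs z.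
Proof. by apply: (fmorph_inj (real_complex R)); exact: (normrN z). Qed.

Lemma cabsBC z w : cabs (z - w) = cabs (w - z).
Proof. by rewrite -cabsN opprB. Qed.

Lemma cabs_real r : cabs r%:C%C = `|r|.
Proof. by rewrite /= expr0n addr0 sqrtr_sqr. Qed.

Lemma cabs_sum (I : Type) (s : seq I) (F : I -> R[i]) :
  cabs (\sum_(i <- s) F i) <= \sum_(i <- s) cabs (F i).
Proof.
elim/big_rec2: _ => [|i y1 y2 _ IH]; first by rewrite ComplexField.Normc.normc0.
by apply: (le_trans (cabsD _ _)); rewrite lerD2l.
Qed.

Lemma Re_le_cabs z : `|complex.Re z| <= cabs z.
Proof. by rewrite -lecR; exact: normc_ge_Re. Qed.

Lemma Im_le_cabs z : `|complex.Im z| <= cabs z.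
Proof.
case: z => a b /=; rewrite -[leLHS]sqrtr_sqr ler_wsqrtr//.
by rewrite lerDr sqr_ge0.
Qed.

Lemma cabs_le_ReIm z : cabs z <= `|complex.Re z| + `|complex.Im z|.
Proof.
have -> : z = (complex.Re z)%:C%C + 'i%C * (complex.Im z)%:C%C by exact: complexE.
apply: (le_trans (cabsD _ _)).
rewrite ComplexField.Normc.normcM !cabs_real /= !expr0n/= expr1n add0r sqrtr1.
by rewrite !(mul0r, mulr0, mul1r, mulr1, add0r, addr0, subr0, oppr0).
Qed.

(** The value 1 at the origin keeps the modulus equal to 1 everywhere, so multiplying by a phase
    never changes the size of an entry. *)
Definition phase z : R[i] := if z == 0 then 1 else (cabs z)%:C%C / z.

Lemma mul_phase z : z * phase z = (cabs z)%:C%C.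
Proof.
rewrite /phase; case: eqVneq => [->|z0].
  by rewrite mul0r ComplexField.Normc.normc0.
by rewrite mulrCA divff// mulr1.
Qed.

Lemma cabs_phase z : cabs (phase z) = 1.
Proof.
rewrite /phase; case: eqVneq => [_|z0]; first by rewrite ComplexField.Normc.normc1.
rewrite ComplexField.Normc.normcM ComplexField.Normc.normcV cabs_real.
rewrite ger0_norm ?cabs_ge0// divff//.
by apply: contra z0 => /eqP/ComplexField.Normc.eq0_normc ->.
Qed.

End Modulus.

(** * Pringsheim limits, finite suprema and geometric convergence *)

Section Limits.
Context {R : realType}.
Local Notation C := (R[i] : numFieldType).
Implicit Types (x y : dseq R).

Lemma p_lim_approx x : Cp x -> forall e : R, 0 < e ->
  exists K, forall k l, (K <= k)%N -> (K <= l)%N -> cabs (x k l - p_lim x) < e.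
Proof.
move=> xp e e0.
have e0' : (0 : C) < e%:C%C by rewrite ltcR.
have /(@cvgrPdist_lt C C) /(_ _ e0') : p_filter x --> (p_lim x : C) by exact: xp.
case=> -[P Q] [[i _ iP] [j _ jQ]] PQ.
exists (maxn i j) => k l; rewrite !geq_max => /andP[ik jk] /andP[il jl].
have := PQ (k, l) (conj (iP _ ik) (jQ _ jl)).
by rewrite /= cabsBC -ltcR.
Qed.

Lemma ereal_sup_ltyP (I : Type) (f : I -> \bar R) :
  (forall i, 0 <= f i)%E ->
  (ereal_sup (range f) < +oo)%E <-> exists M : R, forall i, (f i <= M%:E)%E.
Proof.
move=> f0; split=> [|[M fM]]; last first.
  apply: (@le_lt_trans _ _ M%:E); last exact: ltry.
  by apply: ge_ereal_sup => _ [i _ <-].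
have ub i : (f i <= ereal_sup (range f))%E by apply: ereal_sup_ubound; exists i.
case: (ereal_sup _) ub => [M||] ub // _; first by exists M.
by exists 0 => i; apply: (le_trans (ub i)); rewrite leNye.
Qed.

Lemma bounded_dseqP x :
  bounded_dseq x <-> exists M : R, forall k l, cabs (x k l) <= M.
Proof.
rewrite /bounded_dseq /= ereal_sup_ltyP => [|kl]; last by rewrite lee_fin cabs_ge0.
split=> -[M xM]; exists M; last by move=> kl; rewrite lee_fin.
by move=> k l; have := xM (k, l); rewrite lee_fin.
Qed.

(** The geometric tail 9^-n + 9^-(n+1) + ... equals 9/8 * 9^-n, so the intervals of that radius
    around [f n] are nested; the supremum of their left endpoints lies in all of them. *)
Lemma nested_cvg (f : nat -> R) :
  (forall n, `|f n.+1 - f n| <= 9^-1 ^+ n) ->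
  exists l, forall n, `|l - f n| <= 9 / 8 * 9^-1 ^+ n.
Proof.
move=> fS; pose d n : R := 9 / 8 * 9^-1 ^+ n.
have step n : f n - d n <= f n.+1 - d n.+1 /\ f n.+1 + d n.+1 <= f n + d n.
  have := fS n; rewrite ler_norml /d exprS => /andP[]; set t := _ ^+ n => *; lra.
have lo m n : (m <= n)%N -> f m - d m <= f n - d n.
  elim: n => [|n IH]; first by rewrite leqn0 => /eqP ->.
  rewrite leq_eqVlt => /predU1P[->//|/IH h]; exact: le_trans h (step n).1.
have up m n : (m <= n)%N -> f n + d n <= f m + d m.
  elim: n => [|n IH]; first by rewrite leqn0 => /eqP ->.
  rewrite leq_eqVlt => /predU1P[->//|/IH h]; exact: le_trans (step n).2 h.
have d0 n : 0 <= d n by rewrite /d mulr_ge0// ?exprn_ge0//; lra.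
have cross m n : f m - d m <= f n + d n.
  have := lo _ _ (leq_maxl m n); have := up _ _ (leq_maxr m n).
  have := d0 (maxn m n); lra.
have ub n : ubound (range (fun m => f m - d m)) (f n + d n).
  by move=> _ [m _ <-].
exists (sup (range (fun m => f m - d m))) => n.
have h1 : f n - d n <= sup (range (fun m => f m - d m)).
  by apply: ub_le_sup; [exists (f n + d n) | exists n].
have h2 : sup (range (fun m => f m - d m)) <= f n + d n.
  by apply: ge_sup => //; exists (f 0 - d 0)%R; exists 0%N.
by rewrite -/(d n) ler_norml; apply/andP; split; lra.
Qed.

(** Real and imaginary parts converge separately, which doubles the constant 9/8. *)
Lemma nested_cvgC (f : nat -> R[i]) :
  (forall n, cabs (f n.+1 - f n) <= 9^-1 ^+ n) ->
  exists l, forall n, cabs (l - f n) <= 9 / 4 * 9^-1 ^+ n.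
Proof.
move=> fS.
have [n|a aP] := @nested_cvg (fun n => complex.Re (f n)).
  by rewrite -raddfB; exact: le_trans (Re_le_cabs _) (fS n).
have [n|b bP] := @nested_cvg (fun n => complex.Im (f n)).
  by rewrite -raddfB; exact: le_trans (Im_le_cabs _) (fS n).
exists (a +i* b)%C => n; apply: (le_trans (cabs_le_ReIm _)).
rewrite !raddfB /=; have := aP n; have := bP n; lra.
Qed.

Lemma exp9_le (n : nat) : 9^-1 ^+ n <= (n.+1%:R : R)^-1.
Proof.
by rewrite exprVn lef_pV2 ?posrE ?exprn_gt0 ?ltr0Sn// -natrX ler_nat ltn_expl.
Qed.

End Limits.

(** * Null sequences, strong almost convergence and boundedness *)

Section NullSequences.
Context {R : realType}.
Implicit Types (x y u a : dseq R).

(* Null sequences along the cofinite filter of the index set, a smaller class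
   than the Pringsheim null sequences. *)
Definition c0_dseq : set (dseq R) :=
  [set x | forall e : R, 0 < e -> exists K, forall k l,
     ~~ ((k < K) && (l < K))%N -> cabs (x k l) <= e].

Definition axpy x (c : R) u : dseq R := fun k l => x k l + c%:C%C * u k l.

Lemma c0_finsupp x K :
  (forall k l, ~~ ((k < K) && (l < K))%N -> x k l = 0) -> c0_dseq x.
Proof.
move=> xK e e0; exists K => k l /xK ->.
by rewrite ComplexField.Normc.normc0 ltW.
Qed.

Lemma c0_axpy x c u : c0_dseq x -> c0_dseq u -> c0_dseq (axpy x c u).
Proof.
move=> x0 u0 e e0; have [K xK] := x0 (e / 2) ltac:(lra).
(* Adding 1 keeps the divisor positive when [c] is 0. *)
have c1 : 0 < `|c| + 1 by rewrite ltr_wpDl.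
have [K' uK'] := u0 (e / 2 / (`|c| + 1)) ltac:(by rewrite !divr_gt0).
exists (maxn K K') => k l kl.
have hK : ~~ ((k < K) && (l < K))%N.
  by apply: contra kl => /andP[kK lK]; rewrite (leq_trans kK) ?(leq_trans lK) ?leq_maxl.
have hK' : ~~ ((k < K') && (l < K'))%N.
  by apply: contra kl => /andP[kK lK]; rewrite (leq_trans kK) ?(leq_trans lK) ?leq_maxr.
apply: (le_trans (cabsD _ _)).
rewrite ComplexField.Normc.normcM cabs_real [leRHS](splitr e) lerD ?xK//.
apply: (@le_trans _ _ ((`|c| + 1) * (e / 2 / (`|c| + 1)))).
  by rewrite ler_pM ?cabs_ge0 ?lerDl ?uK'.
by rewrite mulrC divfK// gt_eqF.
Qed.

Lemma sum_window_le (f : nat -> R) (m n K : nat) :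
  (forall k, 0 <= f k) -> (forall k, (K <= k)%N -> f k = 0) ->
  \sum_(m <= k < n) f k <= \sum_(0 <= k < K) f k.
Proof.
move=> f0 fK; have [nm|mn] := leqP n m; first by rewrite big_geq// sumr_ge0.
apply: (@le_trans _ _ (\sum_(0 <= k < maxn n K) f k)).
  rewrite (@big_cat_nat _ _ _ m 0)//= ?leq_max ?(ltnW mn)//.
  rewrite [in leRHS](@big_cat_nat _ _ _ n m)//= ?leq_maxl 1?ltnW//.
  by rewrite addrCA lerDl addr_ge0// sumr_ge0.
rewrite (@big_cat_nat _ _ _ K 0)//= ?leq_maxr//.
rewrite [X in _ + X]big_nat_cond [X in _ + X]big1 ?addr0// => i.
by rewrite andbT => /andP[/fK].
Qed.

(** Off the K by K block each term is at most [e], and the block adds at most its whole mass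
    wherever the window sits. The bound is thus uniform in the corner [(m, n)], as the supremum in
    [window_dev] requires. *)
Lemma window_sum_le x K (e : R) m n q q' : 0 <= e ->
  (forall k l, ~~ ((k < K) && (l < K))%N -> cabs (x k l) <= e) ->
  \sum_(m <= k < m + q) \sum_(n <= l < n + q') cabs (x k l) <=
  q%:R * q'%:R * e + \sum_(0 <= k < K) \sum_(0 <= l < K) cabs (x k l).
Proof.
move=> e0 xK.
pose g k l : R := if ((k < K) && (l < K))%N then cabs (x k l) else 0.
have g0 k l : 0 <= g k l by rewrite /g; case: ifP => // _; exact: cabs_ge0.
apply: (@le_trans _ _
  (\sum_(m <= k < m + q) \sum_(n <= l < n + q') (e + g k l))).
  apply: ler_sum => k _; apply: ler_sum => l _.
  rewrite /g; case: ifPn => [_|/xK]; [by rewrite lerDr | by rewrite addr0].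
under eq_bigr do rewrite big_split/= sumr_const_nat addKn.
rewrite big_split/= sumr_const_nat addKn.
have -> : e *+ q' *+ q = q%:R * q'%:R * e.
  by rewrite -mulrnA -[LHS]mulr_natl mulnC natrM.
rewrite lerD2l; apply: (@le_trans _ _ (\sum_(0 <= k < K) \sum_(0 <= l < K) g k l)).
  apply: (@le_trans _ _ (\sum_(m <= k < m + q) \sum_(0 <= l < K) g k l)).
    apply: ler_sum => k _; apply: sum_window_le => // l Kl.
    by rewrite /g (ltnNge l) Kl andbF.
  apply: sum_window_le => [k|k Kk]; first by rewrite sumr_ge0.
  by rewrite big1// => l _; rewrite /g ltnNge Kk.
apply: ler_sum => k _; apply: ler_sum => l _.
by rewrite /g; case: ifP => // _; exact: cabs_ge0.
Qed.

Lemma window_dev_ge0 x L q q' : (0 <= window_dev x L q q')%E.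
Proof.
apply: (@le_trans _ _ ((((q.+1)%:R * (q'.+1)%:R)^-1 *
     \sum_(0 <= k < 0 + q.+1) \sum_(0 <= l < 0 + q'.+1) cabs (x k l - L))%:E)).
  rewrite lee_fin mulr_ge0 ?invr_ge0 ?mulr_ge0//.
  by apply: sumr_ge0 => k _; apply: sumr_ge0 => l _; exact: cabs_ge0.
by apply: ereal_sup_ubound; exists (0, 0)%N.
Qed.

Lemma c0_strongly_almost_cvg : c0_dseq `<=` strongly_almost_cvg.
Proof.
move=> x x0; exists 0.
have dev_le (e : R) : 0 < e ->
    \forall qq \near (\oo, \oo), (window_dev x 0%R qq.1 qq.2 <= e%:E)%E.
  move=> e0; have [K xK] := x0 (e / 2) ltac:(lra).
  set S := \sum_(0 <= k < K) \sum_(0 <= l < K) cabs (x k l).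
  have S0 : 0 <= S.
    by apply: sumr_ge0 => k _; apply: sumr_ge0 => l _; exact: cabs_ge0.
  (* Only [q] has to be large: since q'+1 >= 1, the bound S / (e/2) <= q already gives S <=
     (q+1)(q'+1) e/2. *)
  exists ([set q | S / (e / 2) <= q%:R], setT).
    by split; [exact: nbhs_infty_ger | exact: filterT].
  move=> [q q'] /= [qS _]; apply: ge_ereal_sup => _ [[m n] _ <-] /=.
  rewrite lee_fin; under eq_bigr do under eq_bigr do rewrite subr0.
  have e20 : 0 <= e / 2 by lra.
  rewrite mulrC ler_pdivrMr ?mulr_gt0//.
  apply: (le_trans (window_sum_le m n q.+1 q'.+1 e20 xK)); rewrite -/S.
  have : S <= q.+1%:R * q'.+1%:R * (e / 2); last by nra.
  rewrite -ler_pdivrMr; last lra.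
  apply: (le_trans qS); rewrite -natrM ler_nat.
  by rewrite (leq_trans (leqnSn q))// leq_pmulr.
apply/fine_cvgP; split.
  near=> qq; rewrite fin_numE gt_eqF ?lt_eqF//.
    apply: (@le_lt_trans _ _ 1%:E); last exact: ltry.
    by near: qq; apply: dev_le.
  by apply: lt_le_trans (window_dev_ge0 _ _ _ _); exact: ltNyr.
apply/cvgrPdist_le => e e0; near=> qq.
have dle : (window_dev x 0%R qq.1 qq.2 <= e%:E)%E by near: qq; apply: dev_le.
move: dle (window_dev_ge0 x 0 qq.1 qq.2) => /=.
case: (window_dev _ _ _ _) => //= r; rewrite !lee_fin sub0r normrN => re r0.
by rewrite ger0_norm.
Unshelve. all: by end_near. Qed.

(** One window size with finite deviation [r] suffices: [cabs (x k l - L)] is a single term of the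
    window with corner [(k, l)], hence at most the window area times [r]. *)
Lemma strongly_almost_cvg_bounded x : strongly_almost_cvg x ->
  exists M : R, forall k l, cabs (x k l) <= M.
Proof.
case=> L /fine_cvgP[/filter_ex[[q q'] /= + _]].
have := window_dev_ge0 x L q q'.
case E : (window_dev x L q q') => [r||] // r0 _.
exists (q.+1%:R * q'.+1%:R * r + cabs L) => k l.
have qq0 : 0 < q.+1%:R * q'.+1%:R :> R by rewrite mulr_gt0.
have : ((((q.+1)%:R * (q'.+1)%:R)^-1 * \sum_(k <= k0 < k + q.+1)
    \sum_(l <= l0 < l + q'.+1) cabs (x k0 l0 - L))%:E <= r%:E)%E.
  by rewrite -E; apply: ereal_sup_ubound; exists (k, l).
rewrite lee_fin mulrC ler_pdivrMr// [r * _]mulrC => Sr.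
rewrite -[x k l](subrK L); apply: (le_trans (cabsD _ _)); rewrite lerD2r.
apply: le_trans Sr.
rewrite big_ltn; last by rewrite addnS ltnS leq_addr.
rewrite [X in _ <= X + _]big_ltn; last by rewrite addnS ltnS leq_addr.
rewrite -addrA lerDl addr_ge0// ?sumr_ge0// => [i _|i _]; first exact: cabs_ge0.
by apply: sumr_ge0 => j _; exact: cabs_ge0.
Qed.

End NullSequences.

(** * The gliding hump over null sequences *)

Section GlidingHump.
Context {R : realType}.

(** [N n] is a Lipschitz constant of [p n] in the sup norm, and [u n] attains it up to a factor 2.
    The step of size 9^-n makes [p n] at least 9^-n * N n / 2; all later steps together move the
    point by at most 9^-n / 4 and so cost at most 9^-n * N n / 4. At least 9^-n * N n / 4 remains,
    which the growth hypothesis makes at least [n]. *)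
Lemma gliding_hump (p : nat -> dseq R -> R) (N : nat -> R) (u : nat -> dseq R) :
  (forall n x y d, c0_dseq x -> c0_dseq y -> 0 <= d ->
     (forall k l, cabs (x k l - y k l) <= d) -> p n x <= p n y + d * N n) ->
  (forall n x c, c0_dseq x ->
     2 * (c * p n (u n)) <= p n (axpy x c (u n)) + p n (axpy x (- c) (u n))) ->
  (forall n, c0_dseq (u n)) -> (forall n k l, cabs (u n k l) <= 1) ->
  (forall n, N n <= 2 * p n (u n)) ->
  (forall n, 4 * 9 ^+ n * n%:R <= N n) ->
  exists2 x, c0_dseq x & forall n, n%:R <= p n x.
Proof.
move=> plip psym uc0 u1 Nu Ngt.
pose r n : R := 9^-1 ^+ n.
have r0 n : 0 < r n by rewrite exprn_gt0// invr_gt0.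
(* By the second hypothesis the values for the two signs sum to at least twice [r n * p n (u n)], so
   the minus sign works whenever the plus sign fails. *)
pose next n x := if r n * p n (u n) <= p n (axpy x (r n) (u n))
  then axpy x (r n) (u n) else axpy x (- r n) (u n).
pose X := fix X n := if n is n'.+1 then next n' (X n') else (fun _ _ => 0 : R[i]).
have Xc0 n : c0_dseq (X n).
  elim: n => [|n IH] /=; first by apply: (@c0_finsupp _ _ 0).
  by rewrite /next; case: ifP => _; exact: c0_axpy.
have Xbig n : r n * p n (u n) <= p n (X n.+1).
  rewrite /= /next; case: ifPn => //; rewrite -ltNge.
  have := psym n (X n) (r n) (Xc0 n); lra.
have Xstep n k l : cabs (X n.+1 k l - X n k l) <= r n.
  have bd c : `|c| = r n -> cabs (axpy (X n) c (u n) k l - X n k l) <= r n.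
    move=> cr; rewrite /axpy addrAC subrr add0r ComplexField.Normc.normcM.
    by rewrite cabs_real cr ler_piMr// ltW.
  by rewrite /= /next; case: ifP => _; apply: bd; rewrite ?normrN gtr0_norm.
have /choice[x xP] (kl : nat * nat) : exists z : R[i],
    forall n, cabs (z - X n kl.1 kl.2) <= 9 / 4 * r n.
  by apply: nested_cvgC => n; exact: Xstep.
pose x' : dseq R := fun k l => x (k, l).
have x'P n k l : cabs (X n k l - x' k l) <= 9 / 4 * r n.
  by rewrite cabsBC; exact: (xP (k, l)).
(* A uniform limit of null sequences is null: half of [e] pays for the distance to [X n], half for
   the tail of [X n]. *)
have x'c0 : c0_dseq x'.
  move=> e e0; near \oo => n.
  have rn : 9 / 4 * r n <= e / 2.
    have : r n <= e * 8^-1; last lra.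
    apply: (le_trans (exp9_le n)); rewrite -[leRHS]invrK lef_pV2 ?posrE//.
      apply: (@le_trans _ _ n%:R); last by rewrite ler_nat.
      by near: n; exact: nbhs_infty_ger.
    by rewrite invr_gt0 mulr_gt0.
  have [K XK] := Xc0 n (e / 2) ltac:(lra).
  exists K => k l /XK Xe; rewrite -[x' k l](subrK (X n k l)).
  apply: (le_trans (cabsD _ _)); rewrite cabsBC.
  have := x'P n k l; lra.
exists x' => // n.
(* The distance bound 9/4 * 9^-(n+1) at stage [n.+1] is exactly [r n / 4]. *)
have d0 : 0 <= r n / 4 by have := r0 n; lra.
have := plip n _ _ _ (Xc0 n.+1) x'c0 d0.
have h k l : cabs (X n.+1 k l - x' k l) <= r n / 4.
  by apply: (le_trans (x'P n.+1 k l)); rewrite /r exprS; lra.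
move=> /(_ h) Xx.
have NX : r n * N n <= 2 * p n (X n.+1).
  apply: le_trans (_ : 2 * (r n * p n (u n)) <= _); last by rewrite ler_pM2l.
  by rewrite mulrCA ler_pM2l.
suff : 4 * n%:R <= r n * N n by lra.
have -> : 4 * n%:R = r n * (4 * 9 ^+ n * n%:R) :> R.
  by rewrite /r exprVn; field; rewrite expf_neq0.
by rewrite ler_pM2l.
Unshelve. all: by end_near. Qed.

End GlidingHump.

(** * Rectangular sums, their Pringsheim limits and absolute summability of a row *)

Section RectangularSums.
Context {R : realType}.
Implicit Types (x y z a : dseq R).

(** The bounds are exclusive, while those of [rect_sums] are inclusive; this is the source of the
    [.+1] shifts between the two. *)
Definition abs_rect a m n : R := \sum_(k < m) \sum_(l < n) cabs (a k l).

Lemma sum_ord_le (f : nat -> R) m n : (forall i, 0 <= f i) -> (m <= n)%N ->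
  \sum_(i < m) f i <= \sum_(i < n) f i.
Proof.
move=> f0 mn; rewrite (big_ord_widen n f mn) [leRHS](bigID (fun i : 'I_n => i < m)%N)/=.
by rewrite lerDl sumr_ge0.
Qed.

Lemma abs_rect_le a m n m' n' : (m <= m')%N -> (n <= n')%N ->
  abs_rect a m n <= abs_rect a m' n'.
Proof.
move=> mm nn; apply: (@le_trans _ _ (abs_rect a m n')).
  by apply: ler_sum => k _; apply: (@sum_ord_le (fun l => cabs (a k l))) => // i;
    exact: cabs_ge0.
apply: (@sum_ord_le (fun k => \sum_(l < n') cabs (a k l))) => // k.
by rewrite sumr_ge0// => l _; exact: cabs_ge0.
Qed.

Lemma sum_block (V : nmodType) (f : nat -> nat -> V) K m n :
  (K <= m)%N -> (K <= n)%N ->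
  \sum_(k < m) \sum_(l < n) (if ((k < K) && (l < K))%N then f k l else 0) =
  \sum_(k < K) \sum_(l < K) f k l.
Proof.
move=> Km Kn.
rewrite (big_ord_widen m (fun k => \sum_(l < K) f k l) Km) [RHS]big_mkcond/=.
apply: eq_bigr => k _; case: ifP => kK; last by rewrite big1.
by rewrite (big_ord_widen n (fun l => f k l) Kn) [RHS]big_mkcond.
Qed.

(** Every finite set of index pairs lies in some square, so the squares are cofinal in the supremum
    that defines the unordered sum. *)
Lemma esum_le_abs_rect a (M : R) :
  (\esum_(kl in [set: nat * nat]) (cabs (a kl.1 kl.2))%:E <= M%:E)%E <->
  forall K, abs_rect a K K <= M.
Proof.
have sqE K : (\sum_(kl \in `I_K `*` `I_K) (cabs (a kl.1 kl.2))%:E)%E =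
    (abs_rect a K K)%:E.
  rewrite -(@pair_fsbig _ _ _ _ _ `I_K `I_K (fun k l => (cabs (a k l))%:E))//=.
  rewrite -fsbig_ord /abs_rect -sumEFin; apply: eq_bigr => k _.
  by rewrite -fsbig_ord -sumEFin.
split=> [aM K|aM].
  rewrite -lee_fin; apply: le_trans aM; apply: esum_ge.
  exists (`I_K `*` `I_K); last by rewrite sqE.
  by split => //; exact: finite_setX.
apply: ge_ereal_sup => _ [X [finX _] <-].
have /finite_seqP[F XF] := finX.
(* [K] exceeds [k + l], hence both coordinates, for every pair in [F]. *)
pose K := (\max_(kl <- F) (kl.1 + kl.2)).+1.
apply: (@le_trans _ _ (\sum_(kl \in `I_K `*` `I_K) (cabs (a kl.1 kl.2))%:E)%E).
  apply: lee_fsum_nneg_subset => //; first exact: finite_setX.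
    apply/subsetP => kl; rewrite XF /= => Fkl.
    have klK : (kl.1 + kl.2 < K)%N.
      by rewrite ltnS; apply: (@leq_bigmax_seq _ _ xpredT (fun kl => kl.1 + kl.2)%N).
    by split => /=; apply: leq_ltn_trans klK; rewrite ?leq_addr ?leq_addl.
  by move=> kl _; rewrite lee_fin cabs_ge0.
by rewrite sqE lee_fin.
Qed.

Lemma cabs_rect_sums_le x m n : cabs (rect_sums x m n) <= abs_rect x m.+1 n.+1.
Proof.
apply: (le_trans (cabs_sum _ _)); apply: ler_sum => k _; exact: cabs_sum.
Qed.

Lemma abs_rect_mul_le a x (d M : R) : 0 <= d -> (forall k l, cabs (x k l) <= d) ->
  (forall K, abs_rect a K K <= M) ->
  forall m n, abs_rect (mul_dseq a x) m n <= d * M.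
Proof.
move=> d0 xd aM m n; apply: (@le_trans _ _ (d * abs_rect a m n)).
  rewrite /abs_rect mulr_sumr; apply: ler_sum => k _.
  rewrite mulr_sumr; apply: ler_sum => l _.
  by rewrite /mul_dseq ComplexField.Normc.normcM mulrC ler_wpM2r ?cabs_ge0.
rewrite ler_wpM2l//; apply: le_trans (aM (maxn m n)).
by rewrite abs_rect_le ?leq_maxl ?leq_maxr.
Qed.

Lemma CS_Cp v x : CS v x -> Cp (rect_sums x).
Proof. by case: v => // -[]. Qed.

(** Everything is compared at one diagonal index beyond all thresholds. The offset [s] lets the same
    estimate give exact differences of limits (with [b] = 0) and plain bounds (with [s] = 0). *)
Lemma p_lim_dist y z (s : R[i]) (b : R) K : Cp y -> Cp z ->
  (forall m n, (K <= m)%N -> (K <= n)%N -> cabs (y m n - z m n - s) <= b) ->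
  cabs (p_lim y - p_lim z - s) <= b.
Proof.
move=> yp zp yzs; apply/ler_addgt0Pr => e e0.
have e20 : 0 < e / 2 by lra.
have [K1 yK] := p_lim_approx yp e20; have [K2 zK] := p_lim_approx zp e20.
pose m := maxn K (maxn K1 K2).
have Km : (K <= m)%N by rewrite leq_maxl.
have K1m : (K1 <= m)%N by rewrite !leq_max leqnn orbT.
have K2m : (K2 <= m)%N by rewrite !leq_max leqnn !orbT.
have := yzs _ _ Km Km; have := yK _ _ K1m K1m; have := zK _ _ K2m K2m.
rewrite (cabsBC (y m m)) => zm ym yzm.
have -> : p_lim y - p_lim z - s =
  (y m m - z m m - s) + ((p_lim y - y m m) + (z m m - p_lim z)) by ring.
have := cabsD (y m m - z m m - s) ((p_lim y - y m m) + (z m m - p_lim z)).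
have := cabsD (p_lim y - y m m) (z m m - p_lim z); lra.
Qed.

Lemma p_lim_sub y z (s : R[i]) K : Cp y -> Cp z ->
  (forall m n, (K <= m)%N -> (K <= n)%N -> y m n - z m n = s) ->
  p_lim y - p_lim z = s.
Proof.
move=> yp zp yzs; apply/eqP; rewrite -subr_eq0; apply/eqP.
apply: ComplexField.Normc.eq0_normc; apply/eqP.
rewrite eq_le cabs_ge0 andbT; apply: (p_lim_dist yp zp (K := K)) => m n Km Kn.
by rewrite yzs// subrr ComplexField.Normc.normc0.
Qed.

Lemma Cp_cst (s : R[i]) : Cp (fun _ _ => s) /\ p_lim (fun _ _ => s) = s.
Proof.
have h : p_filter (fun _ _ => s) --> (s : (R[i] : numFieldType)).
  exact: cvg_cst.
split; first by apply/cvg_ex; exists s.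
exact: (@cvg_lim (R[i] : numFieldType) (@norm_hausdorff _ _) _ _ _ _ _ h).
Qed.

Lemma cabs_p_lim_le y (b : R) : Cp y -> (forall m n, cabs (y m n) <= b) ->
  cabs (p_lim y) <= b.
Proof.
move=> yp yb; have [zp z0] := Cp_cst 0.
have -> : p_lim y = p_lim y - p_lim (fun _ _ => (0 : R[i])) - 0.
  by rewrite z0 !subr0.
by apply: (p_lim_dist (K := 0%N) yp zp) => m n _ _; rewrite !subr0.
Qed.

Lemma p_lim_eventually y (s : R[i]) K : Cp y ->
  (forall m n, (K <= m)%N -> (K <= n)%N -> y m n = s) -> p_lim y = s.
Proof.
move=> yp ys; have [zp z0] := Cp_cst 0.
rewrite -[LHS]subr0 -z0; apply: (p_lim_sub yp zp (K := K)) => m n Km Kn.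
by rewrite subr0 ys.
Qed.

(** First use of the hump, by contradiction: unbounded square sums supply squares [K n] of the
    required growth, and the indicator of each square attains the Lipschitz constant of its
    seminorm. *)
Lemma c0_beta_dual_summable a :
  (forall x, c0_dseq x -> Cp (rect_sums (mul_dseq a x))) ->
  exists M : R, forall K, abs_rect a K K <= M.
Proof.
move=> ax; apply: contrapT => nM.
have /choice[K KP] (n : nat) : exists K, 4 * 9 ^+ n * n%:R <= abs_rect a K K.
  apply: contrapT => nK; apply: nM; exists (4 * 9 ^+ n * n%:R) => K.
  by rewrite leNgt; apply/negP => /ltW h; apply: nK; exists K.
pose u n : dseq R := fun k l => if ((k < K n) && (l < K n))%N then 1 else 0.
have [||||||x x0 xbig] := @gliding_hump R
  (fun n x => abs_rect (mul_dseq a x) (K n) (K n))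
  (fun n => abs_rect a (K n) (K n)) u.
- move=> n x y d _ _ d0 xy; rewrite /abs_rect mulr_sumr -big_split/=.
  apply: ler_sum => k _; rewrite mulr_sumr -big_split/=; apply: ler_sum => l _.
  rewrite /mul_dseq !ComplexField.Normc.normcM [d * _]mulrC -mulrDr.
  rewrite ler_wpM2l ?cabs_ge0// -[x k l](subrK (y k l)).
  by apply: (le_trans (cabsD _ _)); rewrite addrC lerD2l.
- move=> n x c _; rewrite /abs_rect !mulr_sumr -big_split/=.
  apply: ler_sum => k _; rewrite !mulr_sumr -big_split/=; apply: ler_sum => l _.
  rewrite /mul_dseq !ComplexField.Normc.normcM -mulrDr [c * _]mulrCA [2 * _]mulrCA.
  rewrite ler_wpM2l ?cabs_ge0// /axpy rmorphN.
  (* The two perturbations differ by 2 c u, so the triangle inequality gives the symmetrized lower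
     bound term by term. *)
  apply: (@le_trans _ _ (cabs ((x k l + c%:C%C * u n k l) -
      (x k l + - c%:C%C * u n k l)))); last first.
    by apply: (le_trans (cabsD _ _)); rewrite cabsN.
  have -> : (x k l + c%:C%C * u n k l) - (x k l + - c%:C%C * u n k l) =
    (2 * c)%:C%C * u n k l by rewrite rmorphM/= rmorph_nat; ring.
  rewrite ComplexField.Normc.normcM cabs_real normrM ger0_norm// mulrA.
  by rewrite ler_wpM2r ?cabs_ge0// ler_pM2l// ler_norm.
- by move=> n; apply: (@c0_finsupp _ _ (K n)) => k l /negbTE; rewrite /u => ->.
- move=> n k l; rewrite /u; case: ifP => _.
    by rewrite ComplexField.Normc.normc1.
  by rewrite ComplexField.Normc.normc0.
- move=> n.
  have -> : abs_rect (mul_dseq a (u n)) (K n) (K n) = abs_rect a (K n) (K n).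
    apply: eq_bigr => k _; apply: eq_bigr => l _.
    by rewrite /mul_dseq /u !ltn_ord mulr1.
  have : 0 <= abs_rect a (K n) (K n).
    by apply: sumr_ge0 => k _; apply: sumr_ge0 => l _; exact: cabs_ge0.
  lra.
- by [].
(* The rotated sequence has the same moduli, hence is null, and it turns the terms of the series
   into [cabs (a k l * x k l)]. *)
pose y : dseq R := fun k l => x k l * phase (a k l * x k l).
have y0 : c0_dseq y.
  move=> e e0; have [K' xK] := x0 e e0; exists K' => k l /xK.
  by rewrite /y ComplexField.Normc.normcM cabs_phase mulr1.
have [K' yK] := p_lim_approx (ax y y0) ltr01.
set L := p_lim _ in yK.
have yE m n : rect_sums (mul_dseq a y) m n =
    (abs_rect (mul_dseq a x) m.+1 n.+1)%:C%C.
  rewrite /rect_sums /abs_rect rmorph_sum; apply: eq_bigr => k _.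
  rewrite rmorph_sum; apply: eq_bigr => l _.
  by rewrite /mul_dseq /y mulrA mul_phase.
near \oo => n.
(* Beyond [K'] the sums are within 1 of [L], yet the square up to [m] contains the block of size
   [K n], whose sum is at least [n]. *)
pose m := maxn K' (K n).
have K'm : (K' <= m)%N by rewrite leq_maxl.
have Knm : (K n <= m.+1)%N by rewrite (leq_trans _ (leqnSn m))// leq_maxr.
have := yK _ _ K'm K'm; rewrite yE => yL.
have := cabsD ((abs_rect (mul_dseq a x) m.+1 m.+1)%:C%C - L) L.
rewrite subrK cabs_real => h.
have h1 := ler_norm (abs_rect (mul_dseq a x) m.+1 m.+1).
have h2 := abs_rect_le (mul_dseq a x) Knm Knm.
have h3 := xbig n.
have h4 : 1 + cabs L <= n%:R by near: n; exact: nbhs_infty_ger.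
lra.
Unshelve. all: by end_near. Qed.

End RectangularSums.

(** * Row functionals of the matrix and their uniform boundedness *)

Section Transforms.
Context {R : realType}.
Implicit Types (x y a : dseq R).

(** By linearity the difference of the partial sums is a partial sum for [x - y], of modulus at most
    [d * M]; the bound survives the limit. *)
Lemma dsum_lipschitz a x y (d M : R) : 0 <= d ->
  Cp (rect_sums (mul_dseq a x)) -> Cp (rect_sums (mul_dseq a y)) ->
  (forall k l, cabs (x k l - y k l) <= d) -> (forall K, abs_rect a K K <= M) ->
  cabs (dsum (mul_dseq a x)) <= cabs (dsum (mul_dseq a y)) + d * M.
Proof.
move=> d0 axp ayp xyd aM.
have := @p_lim_dist _ _ _ 0 (d * M) 0%N axp ayp; rewrite subr0 => h.
rewrite -[dsum (mul_dseq a x)](subrK (dsum (mul_dseq a y))).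
apply: (le_trans (cabsD _ _)); rewrite addrC lerD2l; apply: h => m n _ _.
have -> : rect_sums (mul_dseq a x) m n - rect_sums (mul_dseq a y) m n - 0 =
    rect_sums (mul_dseq a (fun k l => x k l - y k l)) m n.
  rewrite subr0 /rect_sums -sumrB; apply: eq_bigr => k _.
  by rewrite -sumrB; apply: eq_bigr => l _; rewrite /mul_dseq mulrBr.
exact: le_trans (cabs_rect_sums_le _ _ _) (abs_rect_mul_le d0 xyd aM _ _).
Qed.

(** A finitely supported test sequence with entries of modulus at most 1, on which the series
    against [a] sums to [abs_rect a K K]. *)
Definition block_phase a K : dseq R :=
  fun k l => if ((k < K) && (l < K))%N then phase (a k l) else 0.

Lemma rect_sums_block_phase a K m n : (K <= m)%N -> (K <= n)%N ->
  rect_sums (mul_dseq a (block_phase a K)) m n = (abs_rect a K K)%:C%C.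
Proof.
move=> Km Kn; rewrite /abs_rect rmorph_sum/=.
under [RHS]eq_bigr do rewrite rmorph_sum/=.
rewrite -(@sum_block _ (fun k l => (cabs (a k l))%:C%C) K m.+1 n.+1) ?leqW//.
apply: eq_bigr => k _; apply: eq_bigr => l _; rewrite /mul_dseq /block_phase.
by case: ifP => _; rewrite ?mul_phase ?mulr0.
Qed.

(** Partial sums of the two perturbed series beyond [K] differ by the constant
    [2 * (c * abs_rect a K K)]; so do the limits, and the triangle inequality splits this
    difference. *)
Lemma dsum_axpy_block_phase a x c K :
  Cp (rect_sums (mul_dseq a (block_phase a K))) ->
  (forall c', Cp (rect_sums (mul_dseq a (axpy x c' (block_phase a K))))) ->
  2 * (c * cabs (dsum (mul_dseq a (block_phase a K)))) <=
  cabs (dsum (mul_dseq a (axpy x c (block_phase a K)))) +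
  cabs (dsum (mul_dseq a (axpy x (- c) (block_phase a K)))).
Proof.
move=> up xp; set u := block_phase a K.
have rD m n c' : rect_sums (mul_dseq a (axpy x c' u)) m n =
    rect_sums (mul_dseq a x) m n + c'%:C%C * rect_sums (mul_dseq a u) m n.
  rewrite /rect_sums mulr_sumr -big_split; apply: eq_bigr => k _ /=.
  rewrite mulr_sumr -big_split; apply: eq_bigr => l _ /=.
  by rewrite /mul_dseq /axpy; ring.
set S := abs_rect a K K.
have S0 : 0 <= S.
  by apply: sumr_ge0 => k _; apply: sumr_ge0 => l _; exact: cabs_ge0.
have -> : dsum (mul_dseq a u) = S%:C%C.
  by apply: (p_lim_eventually (K := K) up) => m n; exact: rect_sums_block_phase.
rewrite cabs_real ger0_norm//.
have := @p_lim_sub _ _ _ (2 * (c * S))%:C%C K (xp c) (xp (- c)).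
rewrite -/(dsum _) -/(dsum _) => dE.
apply: (@le_trans _ _ (cabs (dsum (mul_dseq a (axpy x c u)) -
    dsum (mul_dseq a (axpy x (- c) u))))); last first.
  by apply: (le_trans (cabsD _ _)); rewrite cabsN.
rewrite dE ?cabs_real ?ler_norm// => m n Km Kn.
by rewrite !rD rect_sums_block_phase// !rmorphM rmorphN rmorph_nat; ring.
Qed.

(** If every block sum were below M / 2, the total would be at most M / 2, which is absurd once M >
    0. *)
Lemma block_phase_near_norming a (M : R) :
  (\esum_(kl in [set: nat * nat]) (cabs (a kl.1 kl.2))%:E = M%:E)%E ->
  exists K, M <= 2 * abs_rect a K K.
Proof.
move=> aM; apply: contrapT => nK.
have lt2 K : 2 * abs_rect a K K < M.
  by rewrite ltNge; apply/negP => h; apply: nK; exists K.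
(* The empty block gives M > 0. *)
have := lt2 0%N; rewrite {1}/abs_rect big_ord0 mulr0 => M0.
have /esum_le_abs_rect : forall K, abs_rect a K K <= M / 2.
  by move=> K; have := lt2 K; lra.
by rewrite aM lee_fin; lra.
Qed.

(** Second use of the hump: [N] is the absolute sum of a row, finite by [c0_beta_dual_summable], and
    its unboundedness supplies the positions [i n] whose functionals play the role of [p n]. *)
Lemma c0_transform_bounded_rows (A : dmatrix R) :
  (forall x, c0_dseq x -> forall m n, Cp (rect_sums (mul_dseq (A m n) x))) ->
  (forall x, c0_dseq x -> bounded_dseq (transform A x)) ->
  exists M : R, forall m n,
    (\esum_(kl in [set: nat * nat]) (cabs (A m n kl.1 kl.2))%:E <= M%:E)%E.
Proof.
move=> Ap Ab.
have /choice[N NP] (mn : nat * nat) : exists N : R,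
    (\esum_(kl in [set: nat * nat]) (cabs (A mn.1 mn.2 kl.1 kl.2))%:E = N%:E)%E.
  have [M /esum_le_abs_rect AM] :=
    c0_beta_dual_summable (fun x cx => Ap x cx mn.1 mn.2).
  have : (0 <= \esum_(kl in [set: nat * nat])
      (cabs (A mn.1 mn.2 kl.1 kl.2))%:E)%E.
    by apply: esum_ge0 => kl _; rewrite lee_fin cabs_ge0.
  by case: (esum _ _) AM => // r _ _; exists r.
have NK mn K : abs_rect (A mn.1 mn.2) K K <= N mn.
  by move: K; apply/esum_le_abs_rect; rewrite NP.
apply: contrapT => nM.
have /choice[i iP] (n : nat) : exists mn, 4 * 9 ^+ n * n%:R <= N mn.
  apply: contrapT => ni; apply: nM; exists (4 * 9 ^+ n * n%:R) => m' n'.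
  rewrite (NP (m', n')) lee_fin leNgt; apply/negP => /ltW h.
  by apply: ni; exists (m', n').
pose a n := A (i n).1 (i n).2.
have /choice[K KP] n : exists K, N (i n) <= 2 * abs_rect (a n) K K.
  exact: block_phase_near_norming (NP (i n)).
have uc0 n : c0_dseq (block_phase (a n) (K n)).
  apply: (@c0_finsupp _ _ (K n)) => k l /negbTE.
  by rewrite /block_phase => ->.
have [||||||x x0 xbig] := @gliding_hump R
  (fun n x => cabs (dsum (mul_dseq (a n) x))) (fun n => N (i n))
  (fun n => block_phase (a n) (K n)).
- by move=> n x y d x0 y0 d0 xy; apply: dsum_lipschitz => //; [exact: Ap|exact: Ap|exact: NK].
- move=> n x c x0; apply: dsum_axpy_block_phase => [|c']; apply: Ap => //.
  exact: c0_axpy.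
- by [].
- move=> n k l; rewrite /block_phase; case: ifP => _.
    by rewrite cabs_phase.
  by rewrite ComplexField.Normc.normc0.
- move=> n; apply: (le_trans (KP n)); rewrite ler_pM2l//.
  have -> : dsum (mul_dseq (a n) (block_phase (a n) (K n))) =
      (abs_rect (a n) (K n) (K n))%:C%C.
    apply: (p_lim_eventually (K := K n)); first exact: Ap.
    by move=> m' n'; exact: rect_sums_block_phase.
  by rewrite cabs_real ler_norm.
- by [].
have /bounded_dseqP[M xM] := Ab x x0.
(* Once n >= M + 1, the entry of the transform at [i n] has modulus at least [n], against the bound
   [M]. *)
near \oo => n.
have := xbig n; have := xM (i n).1 (i n).2.
have : M + 1 <= n%:R by near: n; exact: nbhs_infty_ger.
rewrite /transform -/(a n); lra.
Unshelve. all: by end_near. Qed.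

Lemma bounded_transform (A : dmatrix R) (M : R) x :
  (forall m n, (\esum_(kl in [set: nat * nat]) (cabs (A m n kl.1 kl.2))%:E <= M%:E)%E) ->
  bounded_dseq x -> (forall m n, Cp (rect_sums (mul_dseq (A m n) x))) ->
  bounded_dseq (transform A x).
Proof.
move=> AM /bounded_dseqP[b xb] Ap; apply/bounded_dseqP; exists (b * M) => m n.
have b0 : 0 <= b := le_trans (cabs_ge0 _) (xb 0%N 0%N).
apply: cabs_p_lim_le => // k l; apply: (le_trans (cabs_rect_sums_le _ _ _)).
by apply: abs_rect_mul_le => //; apply/esum_le_abs_rect.
Qed.

End Transforms.

(** * Both directions of the characterization *)

Theorem corollary4p8 (R : realType) (v : cvg_mode) (A : dmatrix R) :
  matrix_class v strongly_almost_cvg bounded_dseq A <->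
  (forall m n : nat, beta_dual v strongly_almost_cvg (A m n)) /\
  (ereal_sup (range (fun mn : nat * nat =>
     \esum_(kl in [set: nat * nat]) (cabs (A mn.1 mn.2 kl.1 kl.2))%:E))
   < +oo)%E.
Proof.
rewrite ereal_sup_ltyP => [|mn]; last first.
  by apply: esum_ge0 => kl _; rewrite lee_fin cabs_ge0.
split=> [AE|[Abeta [M AM]] x xE].
  split=> [m n x /AE[Acs _]|]; first exact: Acs.
  (* For the norm bound the hypothesis is tested on null sequences only, all of which are strongly
     almost convergent. *)
  have [||M AM] := @c0_transform_bounded_rows R A; last by exists M => -[m n].
    by move=> x /c0_strongly_almost_cvg/AE[Acs _] m n; exact: CS_Cp (Acs m n).
  by move=> x /c0_strongly_almost_cvg/AE[].
split=> [m n|]; first exact: Abeta.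
apply: (@bounded_transform _ _ M) => [m n||m n].
- exact: (AM (m, n)).
- exact/bounded_dseqP/strongly_almost_cvg_bounded.
- exact: CS_Cp (Abeta m n x xE).
Qed.
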